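(* Let $\mathcal{S}=\{1,\dots,S\}$, let $\mathcal{Y}^s\subseteq\mathbb{R}^p$, $s\in\mathcal{S}$, be finite non-empty sets, and let $\mathcal{Y}=\bigoplus_{s\in\mathcal{S}}\mathcal{Y}^s$. Consider $y=y^1+\dots+y^S\in\mathcal{Y}$ with $y^s\in\mathcal{Y}^s$ for all $s\in\mathcal{S}$. Then the following hold. 1. If $y\in\mathcal{Y}_{\mathrm N}$ and $|\mathcal{C}(y)|=1$, then any generator set $\mathcal{G}=\{\mathcal{G}^1,\dots,\mathcal{G}^S\}$ has $y^s\in\mathcal{G}^s$ for all $s\in\mathcal{S}$. 2. If $y\in\mathcal{Y}_{\mathrm N}$ and, for some $\hat s\in\mathcal{S}$, there is a fixed vector $c^{\hat s}$ such that the $\hat s$-th component of every tuple in $\mathcal{C}(y)$ equals $c^{\hat s}$ (so $y^{\hat s}=c^{\hat s}$), then any generator set $\mathcal{G}=\{\mathcal{G}^1,\dots,\mathcal{G}^S\}$ has $y^{\hat s}\in\mathcal{G}^{\hat s}$. 3. For $s\in\mathcal{S}$, if $\mathcal{Y}(y^s)\subseteq\mathcal{Y}_{\mathrm d}$, then $y^s\notin\mathcal{G}^s$ for any minimal generator set $\mathcal{G}=\{\mathcal{G}^1,\dots,\mathcal{G}^S\}$.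
   Context: For sets $A^s\subseteq\mathbb{R}^p$, $\bigoplus_s A^s=\{\sum_s a^s\mid a^s\in A^s\}$ is the Minkowski sum (an empty sum is $\{0\}$). For $u,v\in\mathbb{R}^p$: $u\leqq v$ means $u_i\le v_i$ for all $i$; $u\leq v$ (''$u$ dominates $v$'') means $u\leqq v$ and $u\ne v$. For $A\subseteq\mathbb{R}^p$, $A_{\mathrm N}=\{a\in A\mid\nexists a'\in A:a'\leq a\}$ is the nondominated set and $A_{\mathrm d}=A\setminus A_{\mathrm N}$ the dominated set; $A$ is stable if $A=A_{\mathrm N}$. For $y\in\mathcal{Y}$, $\mathcal{C}(y)=\{(y^1,\dots,y^S)\mid y=y^1+\dots+y^S,\ y^s\in\mathcal{Y}^s,\ s\in\mathcal{S}\}$. For $s\in\mathcal{S}$ and $y^s\in\mathcal{Y}^s$, $\mathcal{Y}(y^s)=\{y^s\}\oplus\bigl(\bigoplus_{\hat s\in\mathcal{S}\setminus\{s\}}\mathcal{Y}^{\hat s}\bigr)$. A generator set is a family $\mathcal{G}=\{\mathcal{G}^1,\dots,\mathcal{G}^S\}$ (indexed by $\mathcal{S}$) of stable sets $\mathcal{G}^s\subseteq\mathcal{Y}^s$ with $\mathcal{Y}_{\mathrm N}=(\bigoplus_{s\in\mathcal{S}}\mathcal{G}^s)_{\mathrm N}$. A generator set $\mathcal{G}$ is minimal if there is no generator set $\tilde{\mathcal{G}}=\{\tilde{\mathcal{G}}^1,\dots,\tilde{\mathcal{G}}^S\}$ with $\tilde{\mathcal{G}}^s\subseteq\mathcal{G}^s$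 for all $s\in\mathcal{S}$ and at least one inclusion strict. *)

(* Defs.v *)
From HB Require Import structures.
From mathcomp Require Import all_boot all_order all_algebra.
From mathcomp Require Import boolp classical_sets cardinality reals.

Set Implicit Arguments.
Unset Strict Implicit.
Unset Printing Implicit Defensive.

Import Order.TTheory GRing.Theory Num.Theory.

Local Open Scope classical_set_scope.
Local Open Scope ring_scope.

Definition weakly_dominates (R : realType) (p : nat) (u v : 'rV[R]_p) : Prop :=
  forall i : 'I_p, u ord0 i <= v ord0 i.

Definition dominates (R : realType) (p : nat) (u v : 'rV[R]_p) : Prop :=
  weakly_dominates u v /\ u <> v.

Definition nondominated (R : realType) (p : nat) (A : set 'rV[R]_p) :
    set 'rV[R]_p :=
  [set a | A a /\ ~ exists a', A a' /\ dominates a' a].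

Definition dominated (R : realType) (p : nat) (A : set 'rV[R]_p) :
    set 'rV[R]_p :=
  A `\` nondominated A.

Definition stable (R : realType) (p : nat) (A : set 'rV[R]_p) : Prop :=
  A = nondominated A.

Definition minkowski_add (R : realType) (p : nat) (A B : set 'rV[R]_p) :
    set 'rV[R]_p :=
  [set a + b | a in A & b in B].

(* The values of [a] outside [P] are unconstrained but do not enter the sum. *)
Definition minkowski_sum (R : realType) (p n : nat) (P : pred 'I_n)
    (A : 'I_n -> set 'rV[R]_p) : set 'rV[R]_p :=
  [set \sum_(s | P s) a s | a in [set a | forall s, P s -> A s (a s)]].

Definition total_sum (R : realType) (p n : nat)
    (A : 'I_n -> set 'rV[R]_p) : set 'rV[R]_p :=
  minkowski_sum xpredT A.

(* The set C(y) of all ways to write [y] as a sum. *)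
Definition decompositions (R : realType) (p n : nat)
    (Y : 'I_n -> set 'rV[R]_p) (y : 'rV[R]_p) : set ('I_n -> 'rV[R]_p) :=
  [set t | y = \sum_s t s /\ forall s, Y s (t s)].

(* Y(y^s), with the index [s] explicit and [ys] standing for y^s *)
Definition sum_through (R : realType) (p n : nat)
    (Y : 'I_n -> set 'rV[R]_p) (s : 'I_n) (ys : 'rV[R]_p) : set 'rV[R]_p :=
  minkowski_add [set ys] (minkowski_sum (fun s' => s' != s) Y).

Definition generator_set (R : realType) (p n : nat)
    (Y G : 'I_n -> set 'rV[R]_p) : Prop :=
  (forall s, G s `<=` Y s /\ stable (G s)) /\
  nondominated (total_sum Y) = nondominated (total_sum G).

Definition minimal_generator_set (R : realType) (p n : nat)
    (Y G : 'I_n -> set 'rV[R]_p) : Prop :=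
  generator_set Y G /\
  ~ exists G' : 'I_n -> set 'rV[R]_p,
      [/\ generator_set Y G',
          forall s, G' s `<=` G s
        & exists s, G' s `<` G s].

(* Main.v *)
Require Import Defs.
From HB Require Import structures.
From mathcomp Require Import all_boot all_order all_algebra.
From mathcomp Require Import boolp classical_sets cardinality reals.
From mathcomp Require Import finmap.

(** The first two claims hold because [Y] and a generator set [G] have the same
    nondominated points: a nondominated [y] is a sum of elements of the sets
    [G s], and such a sum is one of the decompositions of [y] over [Y]. If all
    of these share their component at [s], this component is [ys s], so it lies
    in [G s]. A unique decomposition is the case where this holds at every [s].

    For the third claim, suppose that [G s] contains [ys s] and remove it. No
    nondominated point of [total_sum Y] is lost: each of them is a sum over [G],
    and a sum using [ys s] at [s] lies in [sum_through Y s (ys s)], hence is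
    dominated. So the reduced sums still contain all nondominated points of
    [total_sum Y] ([total_sum_prune_gen]). No other point can become
    nondominated, because [total_sum Y] is finite and in a finite set every
    point is nondominated or lies above a nondominated one
    ([nondominated_below]); this is [nondominated_sandwich]. The reduced family
    is therefore a smaller generator set, and [G] is not minimal. *)

Set Implicit Arguments.
Unset Strict Implicit.
Unset Printing Implicit Defensive.

Import Order.TTheory GRing.Theory Num.Theory.

Local Open Scope classical_set_scope.
Local Open Scope ring_scope.

(** * The dominance order *)

Lemma weakly_dominates_refl (R : realType) (p : nat) (u : 'rV[R]_p) :
  weakly_dominates u u.
Proof. by move=> i. Qed.

Lemma weakly_dominates_trans (R : realType) (p : nat) (u v w : 'rV[R]_p) :
  weakly_dominates u v -> weakly_dominates v w -> weakly_dominates u w.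
Proof. by move=> uv vw i; apply: le_trans (uv i) (vw i). Qed.

(** The coordinate sum is a scalarization: it strictly decreases along
    dominance, which makes its minimizers nondominated. *)
Lemma dominates_sum_lt (R : realType) (p : nat) (u v : 'rV[R]_p) :
  dominates u v -> \sum_i u ord0 i < \sum_i v ord0 i.
Proof.
move=> [uv neq_uv]; rewrite lt_neqAle ler_sum ?andbT => [|i _]; last exact: uv.
apply/eqP => sum_uv; apply: neq_uv.
have gap0 : \sum_i (v ord0 i - u ord0 i) = 0 by rewrite sumrB sum_uv subrr.
have gap_ge0 i : true -> 0 <= v ord0 i - u ord0 i.
  by rewrite subr_ge0 => _; exact: uv.
apply/rowP => i; apply/esym/eqP; rewrite -subr_eq0; apply/eqP.
exact: (psumr_eq0P gap_ge0 gap0).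
Qed.

Lemma nondominated_sub (R : realType) (p : nat) (A B : set 'rV[R]_p) :
  B `<=` A -> nondominated A `&` B `<=` nondominated B.
Proof.
move=> BA a [[_ Na] Ba]; split=> // -[b [Bb ba]].
by apply: Na; exists b; split=> //; exact: BA.
Qed.

Lemma stable_sub (R : realType) (p : nat) (A B : set 'rV[R]_p) :
  B `<=` A -> stable A -> stable B.
Proof.
move=> BA stA; apply/seteqP; split=> [b Bb|b []//].
by apply: (nondominated_sub BA); split=> //; rewrite -stA; exact: BA.
Qed.

(** Among the points of [A] below [a], one with the least coordinate sum is
    nondominated in all of [A], since anything dominating it is also below
    [a]. *)
Lemma nondominated_below (R : realType) (p : nat) (A : set 'rV[R]_p) a :
  finite_set A -> A a -> exists2 b, nondominated A b & weakly_dominates b a.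
Proof.
move=> /finite_fsetP [X ->] /= aX.
pose below (x : X) := `[< weakly_dominates (val x) a >].
have a_below : below [` aX]%fset by apply/asboolP/weakly_dominates_refl.
case: (arg_minP (fun x : X => \sum_i val x ord0 i) a_below) => b /asboolP ba bmin.
exists (val b) => //; split=> /= [|[c [cX cb]]]; first exact: valP.
have c_below : below [` cX]%fset.
  by apply/asboolP/weakly_dominates_trans/ba; case: cb.
by have := bmin _ c_below; rewrite leNgt (dominates_sum_lt cb).
Qed.

Lemma nondominated_sandwich (R : realType) (p : nat) (A B : set 'rV[R]_p) :
  finite_set A -> nondominated A `<=` B -> B `<=` A ->
  nondominated A = nondominated B.
Proof.
move=> finA NAB BA; apply/seteqP; split=> [a Na|b [Bb Nb]].
  by apply: (nondominated_sub BA); split=> //; exact: NAB.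
have [a Na ab] := nondominated_below finA (BA _ Bb).
have [<- //|neq_ab] := pselect (a = b).
by case: Nb; exists a; split; [exact: NAB|].
Qed.

(** * Minkowski sums *)

(** The sums are indexed by functions from ['I_n] into the finite union of the
    summands, and there are finitely many of these. *)
Lemma finite_total_sum (R : realType) (p n : nat) (Y : 'I_n -> set 'rV[R]_p) :
  (forall s, finite_set (Y s)) -> finite_set (total_sum Y).
Proof.
move=> finY.
have /finite_fsetP[X UX] : finite_set (\bigcup_(s in [set: 'I_n]) Y s).
  by apply: bigcup_finite => // s _; exact: finY.
pose sum_of (f : {ffun 'I_n -> X}) : 'rV[R]_p := \sum_s val (f s).
apply: (@sub_finite_set _ _ (sum_of @` setT)); last exact: finite_image.
move=> _ [t tY <-].
have tX s : t s \in X.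
  by have : [set` X] (t s) by rewrite -UX; exists s => //; exact: tY.
exists [ffun s => [` tX s]%fset] => //.
by rewrite /sum_of; apply: eq_bigr => s _; rewrite ffunE.
Qed.

Lemma total_sum_mono (R : realType) (p n : nat) (A B : 'I_n -> set 'rV[R]_p) :
  (forall s, A s `<=` B s) -> total_sum A `<=` total_sum B.
Proof. by move=> AB _ [t tA <-]; exists t => // s _; apply: AB; exact: tA. Qed.

Lemma sum_through_component (R : realType) (p n : nat)
    (Y : 'I_n -> set 'rV[R]_p) (t : 'I_n -> 'rV[R]_p) (s : 'I_n) :
  (forall s', Y s' (t s')) -> sum_through Y s (t s) (\sum_s' t s').
Proof.
move=> tY; exists (t s) => //; exists (\sum_(s' | s' != s) t s').
  by exists t.
by rewrite [RHS](bigD1 s).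
Qed.

(** * Generator sets *)

Lemma generator_decomposition (R : realType) (p n : nat)
    (Y G : 'I_n -> set 'rV[R]_p) (y : 'rV[R]_p) :
  generator_set Y G -> nondominated (total_sum Y) y ->
  exists2 g, decompositions Y y g & forall s, G s (g s).
Proof.
move=> [GY ->] [[g gG <-] _]; exists g => [|s]; last exact: gG.
by split=> // s; apply: (GY s).1; exact: gG.
Qed.

Lemma common_component_in_generator (R : realType) (p n : nat)
    (Y G : 'I_n -> set 'rV[R]_p) (y c : 'rV[R]_p) (s : 'I_n) :
  generator_set Y G -> nondominated (total_sum Y) y ->
  (forall t, decompositions Y y t -> t s = c) -> G s c.
Proof.
move=> genG Ny tc; have [g gy gG] := generator_decomposition genG Ny.
by rewrite -(tc g gy).
Qed.

Definition prune (R : realType) (p n : nat) (G : 'I_n -> set 'rV[R]_p)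
    (s : 'I_n) (v : 'rV[R]_p) : 'I_n -> set 'rV[R]_p :=
  fun s' => G s' `\` [set g | s' = s /\ g = v].

Lemma prune_sub (R : realType) (p n : nat) (G : 'I_n -> set 'rV[R]_p) s v s' :
  prune G s v s' `<=` G s'.
Proof. exact: subDsetl. Qed.

(** A nondominated point generated by [G] cannot use [v] at [s], so any of its
    decompositions over [G] survives the removal of [v]. *)
Lemma total_sum_prune_gen (R : realType) (p n : nat)
    (Y G : 'I_n -> set 'rV[R]_p) (s : 'I_n) (v : 'rV[R]_p) :
  generator_set Y G -> sum_through Y s v `<=` dominated (total_sum Y) ->
  nondominated (total_sum Y) `<=` total_sum (prune G s v).
Proof.
move=> genG vdom y Ny; have [g [yE gY] gG] := generator_decomposition genG Ny.
exists g => // s' _; split=> // -[s'E gv]; subst s'.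
have [//|_] := vdom y; last exact.
by rewrite yE -gv; exact: sum_through_component.
Qed.

Lemma prune_generator_set (R : realType) (p n : nat)
    (Y G : 'I_n -> set 'rV[R]_p) (s : 'I_n) (v : 'rV[R]_p) :
  (forall s', finite_set (Y s')) -> generator_set Y G ->
  sum_through Y s v `<=` dominated (total_sum Y) ->
  generator_set Y (prune G s v).
Proof.
move=> finY genG vdom; have [GY _] := genG.
have pruneY s' : prune G s v s' `<=` Y s'.
  exact: subset_trans (@prune_sub _ _ _ G s v s') (GY s').1.
split=> [s'|].
  split; first exact: pruneY.
  exact: stable_sub (@prune_sub _ _ _ G s v s') (GY s').2.
apply: nondominated_sandwich; first exact: finite_total_sum.
- exact: total_sum_prune_gen.
- exact: total_sum_mono.
Qed.

Theorem proposition3p5 (R : realType) (p n : nat)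
    (Y : 'I_n -> set 'rV[R]_p)
    (Yfin : forall s, finite_set (Y s))
    (Yne : forall s, Y s !=set0)
    (y : 'rV[R]_p) (ys : 'I_n -> 'rV[R]_p)
    (ysY : forall s, Y s (ys s))
    (yE : y = \sum_s ys s) :
  [/\ nondominated (total_sum Y) y -> (decompositions Y y #= `I_1)%card ->
        forall G, generator_set Y G -> forall s, G s (ys s),
      nondominated (total_sum Y) y ->
        forall s, (exists c, forall t, decompositions Y y t -> t s = c) ->
        forall G, generator_set Y G -> G s (ys s)
    & forall s, sum_through Y s (ys s) `<=` dominated (total_sum Y) ->
        forall G, minimal_generator_set Y G -> ~ G s (ys s)].
Proof.
have common s c : (forall t, decompositions Y y t -> t s = c) -> ys s = c.
  by apply; split.
split.
- move=> Ny C1 G genG s; apply: (common_component_in_generator genG Ny).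
  (* The bijection onto [`I_1] is constant, so all decompositions coincide. *)
  have /card_set_bijP[f [fI1 finj _]] := C1.
  have ysC : decompositions Y y ys by split.
  have fC0 t : decompositions Y y t -> f t = 0%N.
    by move=> tC; have := fI1 _ tC; rewrite /= ltnS leqn0 => /eqP.
  move=> t tC; have -> // : t = ys.
  by apply: finj; [exact: mem_set|exact: mem_set|rewrite !fC0].
- move=> Ny s [c cC] G genG; rewrite (common s c cC).
  exact: (common_component_in_generator genG Ny).
- move=> s vdom G [genG minG] Gys; apply: minG.
  exists (prune G s (ys s)); split.
  + exact: prune_generator_set.
  + by move=> s'; exact: prune_sub.
  + exists s; split; first exact: prune_sub.
    by move=> /(_ _ Gys)[_]; apply.
Qed.
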